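(* Let $\delta>0$, $\mathcal{K}=\{\bm{C}\mid \|\bm{C}\|_{tr}\le\delta,\ \bm{C}\in\mathcal{S}^{(d+1)\times(d+1)}\}$, and $T\ge 1$. Let $D$ be an upper bound on the diameter of $\mathcal{K}$ and $G$ an upper bound on the norm of the (sub-)gradients of the losses $f_t$ over $\mathcal{K}$, i.e. $\|\nabla f_t(\bm{C})\|\le G$ for all $\bm{C}\in\mathcal{K}$ and all $t$. Then the Online Compact Convexified Factorization Machine (OCCFM) algorithm described in the context, run with parameters $\eta=\frac{D}{4GT^{3/4}}$ and $\gamma_t=\frac{1}{t^{1/2}}$, attains $$\mathrm{regret}_T=\sum_{t=1}^Tf_t(\bm{C}_t)-\min_{\bm{C}^{*}\in\mathcal{K}}\sum_{t=1}^Tf_t(\bm{C}^{*})\le 12DGT^{3/4}+DGT^{1/4}.$$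
   Context: $\mathcal{S}^{n\times n}$ is the set of real symmetric $n\times n$ matrices; $\|\bm{C}\|_{tr}$ is the nuclear norm (sum of singular values); $\langle \bm{A},\bm{B}\rangle=\mathrm{tr}(\bm{A}^T\bm{B})$; norms of gradients, the diameter of $\mathcal{K}$, and $\|\cdot\|_2$ below are with respect to the entrywise Euclidean (Frobenius) norm. The maximal singular vectors of a matrix are left and right singular vectors $\bm{u},\bm{v}$ belonging to its largest singular value in an SVD. Losses: at round $t$ an instance $(\bm{x}_t,y_t)$ with $\bm{x}_t\in\mathbb{R}^d$ arrives (the sequence of instances and losses is arbitrary); set $\bm{\hat{x}}_t=[\bm{x}_t^T,1]^T\in\mathbb{R}^{d+1}$. The prediction is $\hat{y}_t(\bm{C})=\frac12\bm{\hat{x}}_t^T\bm{C}\bm{\hat{x}}_t$ and the loss is $f_t(\bm{C})=\ell_t(\hat{y}_t(\bm{C}))$ with $\ell_t:\mathbb{R}\to\mathbb{R}$ a differentiable convex function. OCCFM algorithm, with parameters $\eta>0$ and $\{\gamma_t\}$: initialize $\bm{C}_1\in\mathcal{K}$. For $t=1,\dots,T$: receive $(\bm{x}_t,y_t)$ and incur $f_t(\bm{C}_t)$; let $F_t(\bm{C})=\eta\sum_{\tau=1}^{t-1}\langle\nabla f_\tau(\bm{C}_\tau),\bm{C}\rangle+\|\bm{C}-\bm{C}_1\|_2^2$; compute the maximal singular vectors $\bm{u},\bm{v}$ of $-\nabla F_t(\bm{C}_t)$; solve $\bm{\hat{C}}_t=\mathrm{argmin}_{\bm{C}\in\mathcal{K}}\langle\bm{C},\nabla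 F_t(\bm{C}_t)\rangle$ with $\bm{\hat{C}}_t=\delta\bm{u}\bm{v}^T$; set $\bm{C}_{t+1}=(1-\gamma_t)\bm{C}_t+\gamma_t\bm{\hat{C}}_t$. *)

(* Defs.v *)
From HB Require Import structures.
From mathcomp Require Import all_boot all_order all_algebra.
From mathcomp Require Import all_classical all_reals all_analysis.

Set Implicit Arguments.
Unset Strict Implicit.
Unset Printing Implicit Defensive.

Import Order.TTheory GRing.Theory Num.Theory.
Import numFieldNormedType.Exports.

Local Open Scope classical_set_scope.
Local Open Scope ring_scope.

Section Matrices.
Context {R : realType} {n : nat}.
Implicit Types (A B C U V : 'M[R]_n) (s : 'rV[R]_n) (u v : 'cV[R]_n).

Definition mxdot A B : R := \tr (A^T *m B).

(* The norm that MathComp-Analysis puts on matrices is the max norm; it is used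
   below only through the (norm-independent) notion of directional
   derivative. *)
Definition fnorm A : R := Num.sqrt (mxdot A A).

(* The singular values on the diagonal are not required to be sorted. *)
Definition is_svd A U s V : Prop :=
  [/\ U^T *m U = 1%:M, V^T *m V = 1%:M, (forall i, 0 <= s 0 i)
    & A = U *m diag_mx s *m V^T].

(* Every real square matrix has a singular value decomposition, and its
   singular values are unique up to a permutation; [xget] picks one ordering,
   on which [nuclear_norm] does not depend. *)
Definition singular_values A : 'rV[R]_n :=
  xget 0 [set s | exists U V, is_svd A U s V].

Definition nuclear_norm A : R := \sum_i singular_values A 0 i.

Definition maximal_singular_vectors A u v : Prop :=
  exists U s V i, [/\ is_svd A U s V, (forall j, s 0 j <= s 0 i),
    u = col i U & v = col i V].

Definition nuclear_ball (delta : R) : set 'M[R]_n :=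
  [set C | nuclear_norm C <= delta /\ C^T = C].

Definition is_argmin (K : set 'M[R]_n) (g : 'M[R]_n -> R) C : Prop :=
  K C /\ forall B, K B -> g C <= g B.

(* Gradient with respect to [mxdot]: the matrix of the partial derivatives
   in the n * n entries. *)
Definition grad (g : 'M[R]_n -> R) C : 'M[R]_n :=
  \matrix_(i, j) 'D_(delta_mx i j) g C.

End Matrices.

Section OCCFM.
Context {R : realType} {d : nat}.

Definition xhat (x : 'cV[R]_d) : 'cV[R]_(d + 1) := col_mx x 1%:M.

Definition prediction (x : 'cV[R]_d) (C : 'M[R]_(d + 1)) : R :=
  2^-1 * ((xhat x)^T *m C *m xhat x) 0 0.

Definition loss (x : 'cV[R]_d) (ell : R -> R) (C : 'M[R]_(d + 1)) : R :=
  ell (prediction x C).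

(* The surrogate objective F_t built from the loss functions f and the
   iterates C. *)
Definition surrogate (eta : R) (f : nat -> 'M[R]_(d + 1) -> R)
    (C : nat -> 'M[R]_(d + 1)) (t : nat) (B : 'M[R]_(d + 1)) : R :=
  eta * \sum_(1 <= tau < t) mxdot (grad (f tau) (C tau)) B
  + fnorm (B - C 1%N) ^+ 2.

(* [occfm_run delta eta gamma T f C Chat]: C_1, ..., C_(T+1) and
   Chat_1, ..., Chat_T are the matrices produced by some execution of the
   algorithm on the losses f_1, ..., f_T.  The maximal singular vectors need
   not be unique, even up to a common sign (e.g. when the gradient is 0), and
   delta u v^T need not be symmetric for all choices of them; the execution
   uses a choice for which it solves the linear minimization problem over the
   nuclear ball. *)
Record occfm_run (delta eta : R) (gamma : nat -> R) (T : nat)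
    (f : nat -> 'M[R]_(d + 1) -> R) (C Chat : nat -> 'M[R]_(d + 1)) : Prop := {
  occfm_eta_gt0 : 0 < eta;
  occfm_init : nuclear_ball delta (C 1%N);
  occfm_linear : forall t, (1 <= t <= T)%N ->
    let grad_t := grad (surrogate eta f C t) (C t) in
    is_argmin (nuclear_ball delta) (fun B => mxdot B grad_t) (Chat t) /\
    exists u v, maximal_singular_vectors (- grad_t) u v /\
      Chat t = delta *: (u *m v^T);
  occfm_update : forall t, (1 <= t <= T)%N ->
    C t.+1 = (1 - gamma t) *: C t + gamma t *: Chat t
}.

End OCCFM.

(* Main.v *)
Require Import Defs.
From mathcomp Require Import all_boot all_order all_algebra.
From mathcomp Require Import all_classical all_reals all_analysis.
From mathcomp Require Import ring lra.
Import Order.TTheory GRing.Theory Num.Theory.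
Import numFieldNormedType.Exports.
Local Open Scope classical_set_scope.
Local Open Scope ring_scope.

(* By convexity the regret is at most the sum of <g_t, C_t - C*> with
   g_t = grad f_t(C_t).  Compare C_t with the exact minimizer M_t of F_t on K:
   - M_t is follow-the-regularized-leader with a quadratic regularizer, and
     |M_t - M_(t+1)| <= eta G / 2 by strong convexity, so its linear regret is
     at most D^2 / eta + T eta G^2 / 2;
   - the gap h_t = F_t(C_t) - F_t(M_t), which dominates |C_t - M_t|^2, obeys
     h_(t+1) <= (1 - gamma_t) h_t + gamma_t^2 D^2 + eta G sqrt(h_(t+1)),
     whence h_t <= 4 D^2 gamma_t and |C_t - M_t| <= 2 D t^(-1/4).
   Compactness and convexity of K come from the duality
   |A|_tr = max {<W, A> : W orthogonal}, which rests on the singular value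
   decomposition of symmetric matrices. *)

(** * The Frobenius inner product *)

Section FrobeniusProduct.
Context {R : realType} {n : nat}.
Implicit Types (A B : 'M[R]_n) (a : R).

Lemma mxdotE A B : mxdot A B = \sum_i \sum_j A i j * B i j.
Proof.
rewrite /mxdot /mxtrace exchange_big/=; apply: eq_bigr => j _.
by rewrite mxE; apply: eq_bigr => i _; rewrite mxE.
Qed.

Lemma mxdotC A B : mxdot A B = mxdot B A.
Proof.
by rewrite !mxdotE; apply: eq_bigr => i _; apply: eq_bigr => j _; rewrite mulrC.
Qed.

Lemma mxdotDr A B1 B2 : mxdot A (B1 + B2) = mxdot A B1 + mxdot A B2.
Proof. by rewrite /mxdot mulmxDr mxtraceD. Qed.

Lemma mxdotZr a A B : mxdot A (a *: B) = a * mxdot A B.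
Proof. by rewrite /mxdot -scalemxAr mxtraceZ. Qed.

Lemma mxdotNr A B : mxdot A (- B) = - mxdot A B.
Proof. by rewrite -scaleN1r mxdotZr mulN1r. Qed.

Lemma mxdotDl A1 A2 B : mxdot (A1 + A2) B = mxdot A1 B + mxdot A2 B.
Proof. by rewrite !(mxdotC _ B) mxdotDr. Qed.

Lemma mxdotZl a A B : mxdot (a *: A) B = a * mxdot A B.
Proof. by rewrite !(mxdotC _ B) mxdotZr. Qed.

Lemma mxdot0l B : mxdot 0 B = 0.
Proof. by rewrite -(scale0r 0) mxdotZl mul0r. Qed.

Lemma mxdotNl A B : mxdot (- A) B = - mxdot A B.
Proof. by rewrite !(mxdotC _ B) mxdotNr. Qed.

Lemma mxdot_suml (I : Type) (r : seq I) (P : pred I) (F : I -> 'M[R]_n) B :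
  mxdot (\sum_(i <- r | P i) F i) B = \sum_(i <- r | P i) mxdot (F i) B.
Proof.
apply: (big_morph (mxdot^~ B)) => [A1 A2|]; first exact: mxdotDl.
exact: mxdot0l.
Qed.

Lemma mxdot_delta A i j : mxdot A (delta_mx i j) = A i j.
Proof.
rewrite mxdotE (bigD1 i)//= (bigD1 j)//= mxE !eqxx mulr1.
rewrite !big1 ?addr0// => [i' ne_i|j' ne_j].
  by apply: big1 => j' _; rewrite mxE (negPf ne_i) mulr0.
by rewrite mxE (negPf ne_j) andbF mulr0.
Qed.

Lemma mxdot_ge0 A : 0 <= mxdot A A.
Proof.
by rewrite mxdotE; do 2!apply: sumr_ge0 => ? _; rewrite -expr2 sqr_ge0.
Qed.

Lemma fnorm_ge0 A : 0 <= fnorm A.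
Proof. exact: sqrtr_ge0. Qed.

Lemma fnorm_sqr A : fnorm A ^+ 2 = mxdot A A.
Proof. by rewrite sqr_sqrtr ?mxdot_ge0. Qed.

(** Cauchy-Schwarz. Expanding [|a A - b B|^2 >= 0] gives [key]; the weights [a = |B|], [b = |A|]
    yield the bound after division by [|A| |B|]. *)
Lemma mxdot_le_fnorm A B : mxdot A B <= fnorm A * fnorm B.
Proof.
have [fA0 fB0] := (fnorm_ge0 A, fnorm_ge0 B).
have [A2 B2] := (fnorm_sqr A, fnorm_sqr B).
have key a b : 2 * a * b * mxdot A B <= a ^+ 2 * fnorm A ^+ 2 + b ^+ 2 * fnorm B ^+ 2.
  have := mxdot_ge0 (a *: A - b *: B).
  rewrite !(mxdotDl, mxdotDr, mxdotNl, mxdotNr, mxdotZl, mxdotZr) (mxdotC B A).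
  by rewrite A2 B2; lra.
have ab : 0 <= fnorm A * fnorm B by exact: mulr_ge0.
have [d0|d0] := lerP (mxdot A B) 0; first exact: le_trans ab.
have [ab0|] := ltrP 0 (fnorm A * fnorm B).
  rewrite -(ler_pM2l ab0).
  have := key (fnorm B) (fnorm A); lra.
rewrite le_eqVlt ltNge ab orbF mulf_eq0 => /orP[]/eqP fz.
(* When a norm vanishes, the weight on that matrix is free. This choice turns [key] into
   [2 (|B|^2 + 1) <= |B|^2], which is absurd. *)
- have := key ((fnorm B ^+ 2 + 1) / mxdot A B) 1.
  rewrite fz expr0n mulr0 add0r mulr1 -!mulrA mulVf ?gt_eqF// mulr1.
  have := sqr_ge0 (fnorm B); lra.
- have := key 1 ((fnorm A ^+ 2 + 1) / mxdot A B).
  rewrite fz expr0n mulr0 addr0 mulr1 -!mulrA mulVf ?gt_eqF// mulr1.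
  have := sqr_ge0 (fnorm A); lra.
Qed.

End FrobeniusProduct.

(** * Compactness and eigenvectors of symmetric matrices *)

Lemma vec_mx_continuous {R : realType} m n :
  continuous (@vec_mx R m n).
Proof.
move=> v s /= /(nbhs_ballP (vec_mx v)) [e e0 es].
apply/nbhs_ballP; exists e => //= w [_ vw]; apply: es; split=> // i j.
by rewrite !mxE.
Qed.

(** Heine-Borel for matrices, carried over from row vectors: [K] is a closed subset of the image
    under [vec_mx] of a compact box. *)
Lemma compact_closed_bounded_mx {R : realType} m n (K : set 'M[R]_(m, n)) (b : R) :
  closed K -> (forall A i j, K A -> `|A i j| <= b) -> compact K.
Proof.
move=> clK Kb.
have cbox := @rV_compact R (m * n) (fun=> _) (fun=> @segment_compact R (- b) b).
have := @continuous_compact _ _ (@vec_mx R m n) _ _ cbox.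
move=> /(_ (continuous_subspaceT (@vec_mx_continuous R m n))) cimg.
apply: subclosed_compact clK cimg _ => A KA; exists (mxvec A); last exact: mxvecK.
move=> k; rewrite /= in_itv/= -ler_norml.
by case/mxvec_indexP: k => i j; rewrite mxvecE Kb.
Qed.

Lemma continuous_sumr {R : realType} {T : topologicalType} {I : Type} (r : seq I)
    (P : pred I) (F : I -> T -> R) :
  (forall i, P i -> continuous (F i)) ->
  continuous (fun x => \sum_(i <- r | P i) F i x).
Proof. by apply: continuous_big; exact: add_continuous. Qed.

Lemma mulmx_entry_continuous {R : realType} {T : topologicalType} {m n p}
    (F : T -> 'M[R]_(m, n)) (G : T -> 'M[R]_(n, p)) :
  (forall i j, continuous (fun x => F x i j)) ->
  (forall i j, continuous (fun x => G x i j)) ->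
  forall i j, continuous (fun x => (F x *m G x) i j).
Proof.
move=> cF cG i j.
rewrite (_ : (fun _ => _) = fun x => \sum_k F x i k * G x k j); last first.
  by apply/funext => x; rewrite mxE.
by apply: continuous_sumr => k _ x; apply: continuousM; [exact: cF|exact: cG].
Qed.

Lemma trmx_entry_continuous {R : realType} {m n} i j :
  continuous (fun A : 'M[R]_(m, n) => A^T i j).
Proof.
rewrite (_ : (fun _ => _) = fun A : 'M[R]_(m, n) => A j i).
  exact: coord_continuous.
by apply/funext => A; rewrite mxE.
Qed.

Lemma nonpos_quadratic_linear_eq0 {R : realFieldType} (a b : R) :
  (forall t, t * a + t ^+ 2 * b <= 0) -> a = 0.
Proof.
move=> tab; have c0 : 0 < `|b| + 1 by rewrite ltr_wpDl.
(* At this [t] the quadratic equals [t^2 (|b| + 1 + b)] with a positive second factor, so [t], hence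
   [a], must vanish. *)
have := tab (a / (`|b| + 1)).
have -> : a / (`|b| + 1) * a + (a / (`|b| + 1)) ^+ 2 * b =
  (a / (`|b| + 1)) ^+ 2 * (`|b| + 1 + b) by field; rewrite gt_eqF.
rewrite pmulr_lle0; last by have := ler_norm (- b); rewrite normrN; lra.
rewrite le_eqVlt ltNge sqr_ge0 orbF sqrf_eq0 mulf_eq0 invr_eq0 (gt_eqF c0) orbF.
by move=> /eqP.
Qed.

(* The eigenvector maximizes the quadratic form on the unit sphere. *)
Lemma symmetric_mx_eigenvector {R : realType} {n} (A : 'M[R]_n.+1) : A^T = A ->
  exists u l, u *m u^T = (1%:M : 'M[R]_1) /\ u *m A = l *: u.
Proof.
move=> symA.
pose S := [set u : 'rV[R]_n.+1 | (u *m u^T) 0 0 = 1].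
have dotE (u : 'rV[R]_n.+1) : (u *m u^T) 0 0 = \sum_j u 0 j ^+ 2.
  by rewrite mxE; apply: eq_bigr => j _; rewrite mxE expr2.
have dotC (u v : 'rV[R]_n.+1) : (u *m v^T) 0 0 = (v *m u^T) 0 0.
  by rewrite -[u in LHS]trmxK -trmx_mul mxE.
have dot_ge0 (u : 'rV[R]_n.+1) : 0 <= (u *m u^T) 0 0.
  by rewrite dotE sumr_ge0// => j _; rewrite sqr_ge0.
have clS : closed S.
  have cf : continuous (fun u : 'rV[R]_n.+1 => (u *m u^T) 0 0).
    by apply: mulmx_entry_continuous; [exact: coord_continuous|exact: trmx_entry_continuous].
  have /continuous_closedP := cf.
  by move=> /(_ [set x | x = 1]); apply; exact: closed_eq.
have cS : compact S.
  apply: (@compact_closed_bounded_mx _ _ _ _ 1) => // u i j.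
  rewrite /S/= ord1 dotE => u1; rewrite -(@ler_pXn2r _ 2) ?nnegrE// expr1n.
  by rewrite real_normK ?num_real// -u1 (bigD1 j)//= lerDl sumr_ge0// => *; exact: sqr_ge0.
have S0 : S !=set0.
  exists (delta_mx 0 0); rewrite /S/= dotE (bigD1 0)//= mxE eqxx expr1n.
  by rewrite big1 ?addr0// => j /negPf nj; rewrite mxE nj andbF expr0n.
have cq : continuous (fun u : 'rV[R]_n.+1 => (u *m A *m u^T) 0 0).
  apply: mulmx_entry_continuous; last exact: trmx_entry_continuous.
  apply: mulmx_entry_continuous => i j; first exact: coord_continuous.
  exact: cst_continuous.
have [u /set_mem uS umax] := compact_EVT_max S0 cS (continuous_subspaceT cq).
set l := (u *m A *m u^T) 0 0 in umax.
exists u, l; split; first by apply/matrixP => i j; rewrite !ord1 uS mxE.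
have Z a (B : 'M[R]_1) : (a *: B) 0 0 = a * B 0 0 by rewrite mxE.
(* Homogeneity extends the bound from the unit sphere to all vectors. *)
have qle (v : 'rV[R]_n.+1) : (v *m A *m v^T) 0 0 <= l * (v *m v^T) 0 0.
  have := dot_ge0 v; rewrite le_eqVlt => /predU1P[v0|v0].
    have /eqP := esym v0; rewrite {1}dotE psumr_eq0; last by move=> *; exact: sqr_ge0.
    move=> /allP v00; have -> : v = 0.
      apply/rowP => j; rewrite mxE; apply/eqP; rewrite -sqrf_eq0.
      exact/v00/mem_index_enum.
    by rewrite !mul0mx mxE mulr0.
  set s := (v *m v^T) 0 0 in v0 *; have s0 : 0 < Num.sqrt s by rewrite sqrtr_gt0.
  have ss : Num.sqrt s ^+ 2 = s by rewrite sqr_sqrtr// ltW.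
  have NV (B : 'M[R]_n.+1) : ((Num.sqrt s)^-1 *: v *m B *m ((Num.sqrt s)^-1 *: v)^T) 0 0
      = s^-1 * (v *m B *m v^T) 0 0.
    by rewrite linearZ/= -!scalemxAl -scalemxAr !Z mulrA -expr2 exprVn ss.
  have := umax ((Num.sqrt s)^-1 *: v).
  rewrite NV inE /S/= -[X in X *m _]mulmx1 NV mulmx1 -/s mulVf ?gt_eqF// => /(_ erefl).
  by rewrite ler_pdivrMl// mulrC.
(* First-order condition at the maximizer: [qle] at [u + t w] is a quadratic in [t] that is never
   positive and has no constant term. *)
have linA (w : 'rV[R]_n.+1) : ((u *m A - l *: u) *m w^T) 0 0 = 0.
  suff : 2 * ((u *m A - l *: u) *m w^T) 0 0 = 0 by lra.
  apply: (@nonpos_quadratic_linear_eq0 _ _ ((w *m A *m w^T) 0 0 - l * (w *m w^T) 0 0)) => t.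
  have := qle (u + t *: w); rewrite -subr_le0; apply: le_trans.
  have wAu : (w *m A *m u^T) 0 0 = (u *m A *m w^T) 0 0.
    by rewrite dotC trmx_mul symA mulmxA.
  have -> : (u + t *: w)^T = u^T + t *: w^T by rewrite linearD linearZ.
  rewrite !(mulmxDl, mulmxDr, mulNmx) -!(scalemxAl, scalemxAr).
  have E : forall B C : 'M[R]_1, (B + C) 0 0 = B 0 0 + C 0 0 by move=> *; rewrite mxE.
  have N : forall (B : 'M[R]_1), (- B) 0 0 = - B 0 0 by move=> *; rewrite mxE.
  rewrite !(E, Z, N) (dotC w u) wAu uS -/l.
  by rewrite le_eqVlt; apply/orP; left; apply/eqP; ring.
(* Testing against the residual itself makes its squared length zero. *)
have := linA (u *m A - l *: u); rewrite dotE => /eqP.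
rewrite psumr_eq0; last by move=> *; exact: sqr_ge0.
move=> /allP z; apply/eqP; rewrite -subr_eq0; apply/eqP/rowP => j.
by rewrite [RHS]mxE; apply/eqP; rewrite -sqrf_eq0; exact/z/mem_index_enum.
Qed.

(** * Spectral theorem and the nuclear ball *)

(* The Householder reflection exchanging [u] with the first basis vector. *)
Lemma orthogonal_mx_with_row {R : realType} {n} (u : 'rV[R]_n.+1) :
  u *m u^T = (1%:M : 'M[R]_1) ->
  exists H : 'M[R]_n.+1, [/\ H^T = H, H *m H = 1%:M & delta_mx 0 0 *m H = u].
Proof.
move=> uu; set e : 'rV[R]_n.+1 := delta_mx 0 0.
have [ue|ue] := eqVneq u e.
  by exists 1%:M; rewrite trmx1 mulmx1 ue mulmx1.
have [w wE] : exists w, w = u - e by exists (u - e).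
have ee : e *m e^T = (1%:M : 'M[R]_1).
  by rewrite trmx_delta mul_delta_mx; apply/matrixP => i j; rewrite !ord1 !mxE.
have eu : e *m u^T = (u 0 0)%:M.
  by apply/matrixP => i j; rewrite !ord1 -rowE !mxE.
have ue' : u *m e^T = (u 0 0)%:M by rewrite -[u]trmxK -trmx_mul trmxK eu tr_scalar_mx.
have ew : e *m w^T = (u 0 0 - 1)%:M.
  by rewrite wE linearB/= mulmxBr eu ee raddfB.
have ww : w *m w^T = (2 - 2 * u 0 0)%:M.
  rewrite {1}wE mulmxBl ew wE linearB/= mulmxBr uu ue'.
  by apply/matrixP => i j; rewrite !mxE !ord1 !mulr1n; ring.
have u1 : 2 - 2 * u 0 0 != 0.
  apply: contra ue => /eqP u1; rewrite -subr_eq0 -wE.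
  have w0 : \sum_j w 0 j ^+ 2 = 0.
    have : (w *m w^T) 0 0 = 0 by rewrite ww u1 mxE mul0rn.
    by rewrite mxE => ww0; rewrite -[RHS]ww0; apply: eq_bigr => j _; rewrite mxE expr2.
  move/eqP : w0; rewrite psumr_eq0; last by move=> *; exact: sqr_ge0.
  move=> /allP z; apply/eqP/rowP => j.
  by rewrite [RHS]mxE; apply/eqP; rewrite -sqrf_eq0; exact/z/mem_index_enum.
(* The Householder coefficient [2 / |w|^2], by [ww]. *)
pose c := 2 / (2 - 2 * u 0 0).
exists (1%:M - c *: (w^T *m w)); split.
- by rewrite linearB linearZ/= trmx1 trmx_mul trmxK.
- have : (w^T *m w) *m (w^T *m w) = (2 - 2 * u 0 0) *: (w^T *m w).
    by rewrite mulmxA -(mulmxA _ w) ww mul_mx_scalar -scalemxAl.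
  move: (w^T *m w) => W WW.
  rewrite mulmxBl mul1mx mulmxBr mulmx1 -scalemxAl -scalemxAr WW.
  by apply/matrixP => i j; rewrite !mxE /c; field; exact: u1.
- rewrite mulmxBr mulmx1 -scalemxAr mulmxA ew mul_scalar_mx scalerA.
  rewrite (_ : c * _ = -1) ?scaleN1r ?opprK ?wE ?subrKC// /c; field; exact: u1.
Qed.

(** Induction on the size: conjugating by a reflection that moves an eigenvector to the first basis
    vector leaves, by symmetry, the eigenvalue and a smaller symmetric block. *)
Lemma symmetric_mx_spectral {R : realType} {n} (A : 'M[R]_n) : A^T = A ->
  exists (Q : 'M[R]_n) s, Q^T *m Q = 1%:M /\ A = Q *m diag_mx s *m Q^T.
Proof.
elim: n A => [|n IHn] A symA.
  by exists 1%:M, 0; split; apply/matrixP => -[].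
have [u [l [uu uA]]] := symmetric_mx_eigenvector A symA.
have [H [symH HH eH]] := orthogonal_mx_with_row u uu.
have [B BE] : exists B : 'M[R]_(1 + n), B = H *m A *m H by exists (H *m A *m H).
have symB : B^T = B by rewrite BE !trmx_mul symH symA mulmxA.
have eB : delta_mx 0 0 *m B = l *: (delta_mx 0 0 : 'rV[R]_(1 + n)).
  by rewrite BE !mulmxA eH uA -scalemxAl -eH -mulmxA HH mulmx1.
have B0 j : B 0 j = l * (j == 0)%:R.
  by have /rowP/(_ j) := eB; rewrite -rowE !mxE eqxx.
have l0 : lshift n 0 = 0 :> 'I_(1 + n) by apply: val_inj.
have ul : ulsubmx B = l%:M.
  by apply/matrixP => i j; rewrite !mxE !ord1 l0 B0 mulr1.
have ur : ursubmx B = 0.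
  by apply/matrixP => i j; rewrite !mxE !ord1 l0 B0 mulr0.
have dl : dlsubmx B = 0 by rewrite -[dlsubmx B]trmxK trmx_dlsub symB ur trmx0.
have [|Q' [s' [QQ DE]]] := IHn (drsubmx B); first by rewrite trmx_drsub symB.
pose Q : 'M[R]_(1 + n) := block_mx 1%:M 0 0 Q'.
have QTQ : Q^T *m Q = 1%:M.
  rewrite /Q tr_block_mx !trmx0 trmx1 mulmx_block !(mulmx0, mul0mx, addr0, add0r).
  by rewrite mulmx1 QQ -scalar_mx_block.
have BQ : B = Q *m diag_mx (row_mx l%:M s') *m Q^T.
  rewrite -[LHS]submxK ul ur dl DE /Q tr_block_mx !trmx0 trmx1 diag_mx_row.
  rewrite !mulmx_block !(mulmx0, mul0mx, addr0, add0r, mul1mx, mulmx1).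
  by congr block_mx; apply/matrixP => i j; rewrite !ord1 !mxE.
exists (H *m Q), (row_mx l%:M s'); split.
  by rewrite trmx_mul symH mulmxA -(mulmxA Q^T) HH mulmx1.
have -> : A = H *m B *m H by rewrite BE !mulmxA HH mul1mx -mulmxA HH mulmx1.
by rewrite trmx_mul symH BQ !mulmxA.
Qed.

Lemma symmetric_mx_svd {R : realType} {n} (A : 'M[R]_n) : A^T = A ->
  exists U s V, is_svd A U s V.
Proof.
move=> /symmetric_mx_spectral[Q [s [QQ ->]]].
(* The signs of the eigenvalues go into the left factor. A zero eigenvalue gets sign 1, so that
   [diag_mx e] stays orthogonal. *)
pose e : 'rV[R]_n := \row_j if s 0 j < 0 then -1 else 1.
exists (Q *m diag_mx e), (\row_j `|s 0 j|), Q; split => //.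
- rewrite trmx_mul tr_diag_mx mulmxA -(mulmxA _ Q^T) QQ mulmx1 mulmx_diag.
  rewrite -diag_const_mx; congr diag_mx; apply/rowP => j; rewrite !mxE.
  by case: ifP; rewrite ?mulrNN mulr1.
- by move=> i; rewrite mxE.
- rewrite -!mulmxA (mulmxA (diag_mx e)) mulmx_diag.
  congr (_ *m (diag_mx _ *m _)); apply/rowP => j; rewrite !mxE.
  by case: ltrP => sj; [rewrite ltr0_norm// mulrNN mul1r|rewrite ger0_norm// mul1r].
Qed.

Lemma orthogonal_mx_entry_le1 {R : realType} {n} (Q : 'M[R]_n) i j :
  Q^T *m Q = 1%:M -> `|Q i j| <= 1.
Proof.
move=> /matrixP/(_ j j); rewrite !mxE eqxx => QQ.
rewrite -(@ler_pXn2r _ 2) ?nnegrE// expr1n real_normK ?num_real//.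
rewrite -[X in _ <= X]QQ (bigD1 i)//= mxE -expr2 lerDl sumr_ge0// => k _.
by rewrite mxE -expr2 sqr_ge0.
Qed.

Lemma orthogonal_mulmx {R : realType} {n} (P Q : 'M[R]_n) :
  P^T *m P = 1%:M -> Q^T *m Q = 1%:M -> (P *m Q)^T *m (P *m Q) = 1%:M.
Proof. by move=> PP QQ; rewrite trmx_mul mulmxA -(mulmxA _ P^T) PP mulmx1. Qed.

Lemma orthogonal_trmx {R : realType} {n} (Q : 'M[R]_n) :
  Q^T *m Q = 1%:M -> Q^T^T *m Q^T = 1%:M.
Proof. by rewrite trmxK => /mulmx1C. Qed.

(** * Duality for the nuclear norm; convexity and compactness of its balls *)

Section NuclearNorm.
Context {R : realType} {n : nat}.
Implicit Types (A U V W : 'M[R]_n) (s : 'rV[R]_n).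

(** By cyclicity of the trace, the left side is a sum of singular values weighted by diagonal
    entries of an orthogonal matrix, each at most 1. *)
Lemma mxdot_le_svd A U s V W : is_svd A U s V -> W^T *m W = 1%:M ->
  mxdot W A <= \sum_i s 0 i.
Proof.
move=> [UU VV s0 ->] WW; rewrite /mxdot !mulmxA mxtrace_mulC !mulmxA.
rewrite /mxtrace ler_sum// => i _; rewrite mul_mx_diag mxE ler_piMl//.
apply: le_trans (ler_norm _) _; apply: orthogonal_mx_entry_le1.
by apply: orthogonal_mulmx => //; apply: orthogonal_mulmx; exact: orthogonal_trmx.
Qed.

Lemma mxdot_eq_svd A U s V : is_svd A U s V ->
  mxdot (U *m V^T) A = \sum_i s 0 i.
Proof.
move=> [UU VV _ ->]; rewrite /mxdot trmx_mul trmxK !mulmxA mxtrace_mulC !mulmxA.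
rewrite VV mul1mx UU mul1mx /mxtrace.
by apply: eq_bigr => i _; rewrite mxE eqxx mulr1n.
Qed.

(** Existence of an SVD ensures that [xget] returns genuine singular values and not its default
    [0]. *)
Lemma nuclear_norm_svd A : A^T = A ->
  exists U s V, is_svd A U s V /\ nuclear_norm A = \sum_i s 0 i.
Proof.
move=> /symmetric_mx_svd[U [s [V svdA]]].
have [U' [V' svdA']] : exists U V, is_svd A U (singular_values A) V.
  by apply: (@xgetPex _ 0 [set s | exists U V, is_svd A U s V]); exists s, U, V.
by exists U', (singular_values A), V'.
Qed.

(** The bound becomes a family of linear inequalities, from which convexity and closedness of the
    ball are read off. The supremum is attained at [U V^T]. *)
Lemma nuclear_norm_leP A b : A^T = A ->
  nuclear_norm A <= b <-> forall W, W^T *m W = 1%:M -> mxdot W A <= b.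
Proof.
move=> /nuclear_norm_svd[U [s [V [svdA ->]]]]; split=> [sb W WW|].
  exact: le_trans (mxdot_le_svd _ _ _ _ _ svdA WW) sb.
rewrite -(mxdot_eq_svd _ _ _ _ svdA); apply.
by case: svdA => UU VV _ _; apply: orthogonal_mulmx => //; exact: orthogonal_trmx.
Qed.

Lemma entry_le_nuclear_norm A i j : A^T = A -> `|A i j| <= nuclear_norm A.
Proof.
move=> /nuclear_norm_svd[U [s [V [[UU VV s0 ->] ->]]]].
rewrite mxE (le_trans (ler_norm_sum _ _ _))// ler_sum// => k _.
rewrite mul_mx_diag !mxE !normrM (ger0_norm (s0 k)) mulrAC ler_piMl//.
by rewrite mulr_ile1// orthogonal_mx_entry_le1.
Qed.

Lemma nuclear_ball_setE (b : R) : @nuclear_ball R n b =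
  \bigcap_(W in [set W | W^T *m W = 1%:M]) [set A | mxdot W A <= b]
  `&` [set A | A^T = A].
Proof.
apply/seteqP; split=> A /= [nA symA]; split=> //.
- by move=> W; apply: (nuclear_norm_leP _ _ symA).1.
- exact: (nuclear_norm_leP _ _ symA).2.
Qed.

Lemma nuclear_ball_convex (b t : R) A B : 0 <= t <= 1 ->
  nuclear_ball b A -> nuclear_ball b B ->
  nuclear_ball b ((1 - t) *: A + t *: B).
Proof.
rewrite nuclear_ball_setE => /andP[t0 t1] [nA symA] [nB symB]; split.
- move=> W WW /=; rewrite mxdotDr !mxdotZr.
  by have /= := nA _ WW; have /= := nB _ WW; nra.
- by rewrite /= linearD !linearZ/= symA symB.
Qed.

Lemma mxdot_continuous W : continuous (mxdot W).
Proof.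
apply: continuous_sumr => i _; apply: mulmx_entry_continuous => j k.
- exact: cst_continuous.
- exact: coord_continuous.
Qed.

Lemma nuclear_ball_compact (b : R) : compact (@nuclear_ball R n b).
Proof.
apply: (@compact_closed_bounded_mx _ _ _ _ b) => [|A i j [nA symA]]; last first.
  exact: le_trans (entry_le_nuclear_norm _ _ _ symA) nA.
rewrite nuclear_ball_setE; apply: closedI.
  apply: closed_bigI => W _.
  have /continuous_closedP := mxdot_continuous W.
  by move=> /(_ [set x | x <= b]); apply; exact: closed_le.
rewrite (_ : [set A | A^T = A] =
  \bigcap_(p in [set: 'I_n * 'I_n]) [set A | A p.2 p.1 - A p.1 p.2 = 0]).
  apply: closed_bigI => -[i j] _ /=.
  have cB : continuous (fun A : 'M[R]_n => A j i - A i j).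
    by move=> A; apply: continuousB; exact: coord_continuous.
  have /continuous_closedP := cB.
  by move=> /(_ [set x | x = 0]); apply; exact: closed_eq.
apply/seteqP; split=> A /= symA.
  by move=> [i j] _ /=; rewrite -{1}symA mxE subrr.
apply/matrixP => i j; rewrite mxE; apply/eqP.
by rewrite -subr_eq0; apply/eqP; exact: (symA (i, j)).
Qed.

Lemma nuclear_ball0 (b : R) : 0 <= b -> nuclear_ball b (0 : 'M[R]_n).
Proof.
move=> b0; have sym0 : (0 : 'M[R]_n)^T = 0 by rewrite trmx0.
split=> //; apply/nuclear_norm_leP => // W _.
by rewrite mxdotC mxdot0l.
Qed.

End NuclearNorm.

(** * Gradients of the losses and of the surrogate *)

(** For [h != 0] the difference quotient is exactly [c + h k]. *)
Lemma derive_quadratic {R : realType} {V : normedModType R} (f : V -> R) (a v : V) (c k : R) :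
  (forall h, f (h *: v + a) - f a = h * c + h ^+ 2 * k) -> 'D_v f a = c.
Proof.
move=> fE; apply/cvg_lim => //.
apply: (@cvg_trans _ ((fun h : R => c + h * k) @ 0^')).
  apply: near_eq_cvg; near=> h.
  rewrite /= fE; have h0 : h != 0 by near: h; exact: nbhs_dnbhs_neq.
  by rewrite /GRing.scale/=; field.
suff : (fun h : R => c + h * k) @ 0^' --> c + 0 * k by rewrite mul0r addr0.
apply: cvgD; first exact: cvg_cst.
by apply: cvgM; [exact: nbhs_dnbhs|exact: cvg_cst].
Unshelve. all: by end_near. Qed.

Lemma derive_scale {R : realType} (f : R -> R) (a v : R) :
  derivable f a 1 -> 'D_v f a = 'D_1 f a * v.
Proof.
move=> /derivable1_diffP df; rewrite !deriveE// mulrC -[LHS](_ : 'd f a (v *: 1) = _).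
  by rewrite linearZ.
by rewrite /GRing.scale/= mulr1.
Qed.

(** For [0 < t <= 1], convexity bounds the difference quotient in direction [b - a] by [f b - f a];
    the bound passes to the limit from the right. *)
Lemma convex_tangent_le {R : realType} (f : R -> R) (a b : R) :
  convex_function setT f -> derivable f a 1 ->
  'D_1 f a * (b - a) <= f b - f a.
Proof.
move=> cf df; rewrite -derive_scale//.
have dv : derivable f a (b - a) by apply: diff_derivable; exact/derivable1_diffP.
have cvgD := cvg_dnbhs_at_right dv.
apply: (cvgr_to_le cvgD); near=> t.
have t0 : 0 < t by near: t; exact: nbhs_right_gt.
have t1 : t <= 1 by near: t; exact: nbhs_right_le.
rewrite /= /GRing.scale/= ler_pdivrMl//.
have := cf (Itv01 (ltW t0) t1) b a; rewrite !inE => /(_ Logic.I Logic.I).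
rewrite [X in _ <= X]convRE/=; set c := (X in f X <= _).
have -> : c = t * (b - a) + a by rewrite /c [LHS]convRE/= /unstable.onem; ring.
by rewrite /unstable.onem; lra.
Unshelve. all: by end_near. Qed.

Section Gradients.
Context {R : realType}.

Lemma grad_surrogate {d} (eta : R) (f : nat -> 'M[R]_(d + 1) -> R) C t A :
  grad (surrogate eta f C t) A =
  eta *: (\sum_(1 <= tau < t) grad (f tau) (C tau)) + 2 *: (A - C 1%N).
Proof.
apply/matrixP => i j; rewrite -!mxdot_delta.
set S := \sum_(1 <= tau < t) grad (f tau) (C tau).
have FE B : surrogate eta f C t B = eta * mxdot S B + mxdot (B - C 1%N) (B - C 1%N).
  by rewrite /surrogate fnorm_sqr /S mxdot_suml.
rewrite mxdot_delta mxE.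
apply: (@derive_quadratic _ _ _ _ _ _ (mxdot (delta_mx i j) (delta_mx i j))) => h.
rewrite !FE.
rewrite !(mxdotDl, mxdotDr, mxdotNl, mxdotNr, mxdotZl, mxdotZr).
rewrite !(mxdotC (delta_mx i j) _).
ring.
Qed.

Lemma predictionE {d} (x : 'cV[R]_d) A :
  prediction x A = mxdot (2^-1 *: (xhat x *m (xhat x)^T)) A.
Proof.
rewrite mxdotZl /prediction; congr (_ * _).
by rewrite /mxdot trmx_mul trmxK -[X in mxtrace X]mulmxA mxtrace_mulC /mxtrace big_ord1.
Qed.

Lemma grad_loss {d} (x : 'cV[R]_d) (ell : R -> R) A :
  derivable ell (prediction x A) 1 ->
  grad (loss x ell) A =
  'D_1 ell (prediction x A) *: (2^-1 *: (xhat x *m (xhat x)^T)).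
Proof.
move=> dl; set P := 2^-1 *: _; apply/matrixP => i j; rewrite mxE [RHS]mxE.
transitivity ('D_(prediction x (delta_mx i j)) ell (prediction x A)).
  (* The prediction is linear, so the difference quotients of the loss along [delta_mx i j] are
     those of [ell] along the scalar [prediction x (delta_mx i j)]. *)
  apply: (congr1 (fun g : R -> R => lim (g @ 0^'))); apply/funext => h /=.
  by rewrite /loss !predictionE -/P mxdotDr mxdotZr.
by rewrite derive_scale// [X in _ * X]predictionE mxdot_delta.
Qed.

Lemma loss_tangent_le {d} (x : 'cV[R]_d) (ell : R -> R) A B :
  convex_function setT ell -> (forall r, derivable ell r 1) ->
  loss x ell A - loss x ell B <= mxdot (grad (loss x ell) A) (A - B).
Proof.
move=> cl dl; rewrite grad_loss// mxdotZl mxdotDr mxdotNr -!predictionE /loss.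
have := convex_tangent_le ell (prediction x A) (prediction x B) cl (dl _); lra.
Qed.

Lemma loss_continuous {d} (x : 'cV[R]_d) (ell : R -> R) :
  (forall r, derivable ell r 1) -> continuous (loss x ell).
Proof.
move=> dl A; apply: continuous_comp.
  rewrite (_ : prediction x = mxdot (2^-1 *: (xhat x *m (xhat x)^T))).
    exact: mxdot_continuous.
  by apply/funext => B; rewrite predictionE.
by apply: differentiable_continuous; apply/derivable1_diffP.
Qed.

End Gradients.

(** * Conditional gradient steps on a quadratic objective *)

Lemma nonneg_quadratic_linear_ge0 {R : realFieldType} (a b : R) : 0 <= b ->
  (forall t, 0 <= t <= 1 -> 0 <= t * a + t ^+ 2 * b) -> 0 <= a.
Proof.
move=> b0 tab; rewrite leNgt; apply/negP => a0.
have c0 : 0 < b - a by lra.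
(* If [a < 0], the quadratic takes the negative value [a^3 / (b - a)^2] at this point of the unit
   interval. *)
have /tab : 0 <= - a / (b - a) <= 1.
  rewrite ler_pdivrMr// mul1r lerDr b0 andbT.
  by rewrite divr_ge0 ?oppr_ge0 ?(ltW a0) ?(ltW c0).
have -> : - a / (b - a) * a + (- a / (b - a)) ^+ 2 * b = a ^+ 3 / (b - a) ^+ 2.
  by field; rewrite gt_eqF.
have : a ^+ 3 / (b - a) ^+ 2 < 0.
  by rewrite pmulr_llt0 ?invr_gt0 ?exprn_gt0// exprn_odd_lt0.
by lra.
Qed.

Section QuadraticObjective.
Context {R : realType} {n : nat}.
Implicit Types (A B M S V : 'M[R]_n) (K : set 'M[R]_n).

(** The surrogate as a function of the gradient sum [S], so that a new round replaces [S] by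
    [S + g]. *)
Definition quad_obj (eta : R) C1 S B : R :=
  eta * mxdot S B + mxdot (B - C1) (B - C1).

Definition mx_convex K := forall (t : R) A B, 0 <= t <= 1 ->
  K A -> K B -> K ((1 - t) *: A + t *: B).

Lemma quad_objE eta C1 S A V (t : R) :
  quad_obj eta C1 S ((1 - t) *: A + t *: V) = quad_obj eta C1 S A
    + t * mxdot (eta *: S + 2 *: (A - C1)) (V - A) + t ^+ 2 * mxdot (V - A) (V - A).
Proof.
rewrite /quad_obj !(mxdotDl, mxdotDr, mxdotNl, mxdotNr, mxdotZl, mxdotZr).
rewrite (mxdotC V A) (mxdotC V C1) (mxdotC A C1); ring.
Qed.

(** The expansion [quad_objE] is exact, with curvature term [|X - M|^2]; its linear term is
    nonnegative because [M] minimizes over segments of [K]. *)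
Lemma argmin_quad_growth K eta C1 S M X : mx_convex K ->
  is_argmin K (quad_obj eta C1 S) M -> K X ->
  fnorm (X - M) ^+ 2 <= quad_obj eta C1 S X - quad_obj eta C1 S M.
Proof.
move=> cK [KM minM] KX; rewrite fnorm_sqr.
have XE := quad_objE eta C1 S M X.
have := XE 1; rewrite subrr scale0r add0r scale1r => ->.
suff : 0 <= mxdot (eta *: S + 2 *: (M - C1)) (X - M) by lra.
apply: (@nonneg_quadratic_linear_ge0 _ _ (mxdot (X - M) (X - M))); first exact: mxdot_ge0.
by move=> t t01; have := minM _ (cK t M X t01 KM KX); rewrite XE; lra.
Qed.

(** The linear term at [V] is at most that at [M], and the latter equals [F(M) - F(A) - |M - A|^2].
    This contracts the gap by [1 - t], up to the curvature term. *)
Lemma conditional_gradient_step K eta C1 S A V M (t : R) : 0 <= t -> K M ->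
  is_argmin K (fun B => mxdot B (eta *: S + 2 *: (A - C1))) V ->
  quad_obj eta C1 S ((1 - t) *: A + t *: V) - quad_obj eta C1 S M
  <= (1 - t) * (quad_obj eta C1 S A - quad_obj eta C1 S M)
     + t ^+ 2 * fnorm (V - A) ^+ 2.
Proof.
move=> t0 KM [KV minV]; rewrite fnorm_sqr quad_objE.
have := quad_objE eta C1 S A M 1.
rewrite subrr scale0r add0r scale1r => ->.
have VM : mxdot (eta *: S + 2 *: (A - C1)) (V - A)
    <= mxdot (eta *: S + 2 *: (A - C1)) (M - A).
  rewrite !(mxdotDr (eta *: _ + _)) lerD2r !(mxdotC (_ + _)).
  exact: minV.
have := ler_wpM2l t0 (ler_wpDr (mxdot_ge0 (M - A)) VM).
move: (mxdot _ (V - A)) (mxdot _ (M - A)) => g L.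
by move: (mxdot (V - A) _) (mxdot (M - A) _) (quad_obj _ _ _ _) => p q f; lra.
Qed.

End QuadraticObjective.

(* With time [w ^ 4], the optimality gap [y ^ 2] of the iterate stays below
   [(2 * D / w) ^ 2], i.e. below [4 * D ^ 2] times the step size. *)
Lemma gap_recursion {R : realFieldType} (D a w w' y y' : R) :
  0 < D -> 1 <= w -> 0 < w' -> w' ^+ 4 = w ^+ 4 + 1 ->
  a <= D / (4 * w ^+ 3) -> 0 <= y <= 2 * D / w -> 0 <= y' ->
  y' ^+ 2 <= (1 - 1 / w ^+ 2) * y ^+ 2 + (1 / w ^+ 2) ^+ 2 * D ^+ 2 + a * y' ->
  y' <= 2 * D / w'.
Proof.
move=> D0 w1 w'0 ww' aD /andP[y0 yD] y'0 step; rewrite leNgt; apply/negP => y'D.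
have w0 : 0 < w by lra.
have w'w : w <= w' by rewrite -(@ler_pXn2r _ 4) ?nnegrE ?ltW// ww'; lra.
have [i [i0 iw iE]] : exists i, [/\ 0 < i, i * w = 1 & i = w^-1].
  by exists w^-1; rewrite invr_gt0 mulVf ?gt_eqF.
have [i' [i'0 iw' iE']] : exists i, [/\ 0 < i, i * w' = 1 & i = w'^-1].
  by exists w'^-1; rewrite invr_gt0 mulVf ?gt_eqF.
have i'i : i' <= i by rewrite iE iE' lef_pV2.
have i1 : i <= 1 by rewrite iE invf_le1.
have aE : a <= D * i ^+ 3 / 4 by rewrite (le_trans aD)// iE exprVn invfM; lra.
move: yD y'D step; rewrite !mul1r -!exprVn -iE -iE' => yD y'D step.
have q1 : i ^+ 2 <= 1 by rewrite exprn_ile1// ltW.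
have q0 : 0 < i ^+ 2 by rewrite exprn_gt0.
have q2 : i ^+ 4 <= i ^+ 2 by rewrite (exprM i 2 2) expr2 ler_piMl// ltW.
have q3 : i ^+ 6 <= i ^+ 2.
  by rewrite (exprM i 2 3) -[leRHS]expr1 ler_wiXn2l// ltW.
have q30 : 0 < i ^+ 6 by rewrite exprn_gt0.
(* The target shrinks only at order [i^4]: since [w'^4 = w^4 + 1], one has
   [w'^2 <= w^2 + i^2 / 2]. *)
have q'q : i ^+ 2 - i ^+ 4 / 2 <= i' ^+ 2.
  have w'2 : w' ^+ 2 <= w ^+ 2 + i ^+ 2 / 2.
    rewrite -(@ler_pXn2r _ 2) ?nnegrE ?addr_ge0 ?divr_ge0 ?sqr_ge0// -exprM ww'.
    have -> : (w ^+ 2 + i ^+ 2 / 2) ^+ 2 = w ^+ 4 + (i * w) ^+ 2 + i ^+ 4 / 4.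
      by field.
    by rewrite iw expr1n lerDl divr_ge0// exprn_ge0// ltW.
  have c0 : 0 <= i ^+ 2 - i ^+ 4 / 2 by lra.
  have := ler_wpM2l c0 w'2.
  have -> : (i ^+ 2 - i ^+ 4 / 2) * (w ^+ 2 + i ^+ 2 / 2)
    = (i * w) ^+ 2 + i ^+ 4 / 2 - i ^+ 2 * (i * w) ^+ 2 / 2 - i ^+ 6 / 4 by field.
  rewrite iw expr1n mulr1 => le1.
  have : (i ^+ 2 - i ^+ 4 / 2) * w' ^+ 2 <= 1 by lra.
  rewrite -ler_pdivlMr ?exprn_gt0// => /le_trans; apply.
  by rewrite iE' exprVn div1r.
have i3 : i ^+ 3 / 8 <= i'.
  rewrite -(@ler_pXn2r _ 2) ?nnegrE ?divr_ge0 ?exprn_ge0 ?(ltW i0) ?(ltW i'0)//.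
  by apply: le_trans q'q; rewrite expr_div_n -exprM; lra.
have yy : y ^+ 2 <= 4 * D ^+ 2 * i ^+ 2.
  rewrite -[4 * D ^+ 2 * i ^+ 2](_ : (2 * D * i) ^+ 2 = _); last by ring.
  by rewrite ler_pXn2r ?nnegrE ?mulr_ge0 ?(ltW D0) ?(ltW i0).
have s1 : y' ^+ 2 - D * i ^+ 3 / 4 * y' <= D ^+ 2 * (4 * i ^+ 2 - 3 * i ^+ 4).
  have : a * y' <= D * i ^+ 3 / 4 * y' by rewrite ler_wpM2r.
  have : (1 - i ^+ 2) * y ^+ 2 <= (1 - i ^+ 2) * (4 * D ^+ 2 * i ^+ 2).
    by rewrite ler_wpM2l// subr_ge0.
  lra.
(* The map [z (z - D i^3 / 4)] increases for [z >= 2 D i'], by [i3]. So [y' > 2 D i'] pushes it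
   above [D^2 (4 i^2 - 5/2 i^4)], while [s1] caps it at [D^2 (4 i^2 - 3 i^4)]. *)
have s2 : 2 * D * i' * (2 * D * i' - D * i ^+ 3 / 4) < y' * (y' - D * i ^+ 3 / 4).
  apply: ltr_pM; rewrite ?mulr_ge0 ?subr_ge0 ?ltrD2r ?(ltW D0) ?(ltW i'0)//.
  by have := ler_wpM2l (ltW D0) i3; lra.
have s3 : i' * i ^+ 3 <= i ^+ 4 by rewrite [leRHS]exprS ler_wpM2r// exprn_ge0// ltW.
have : D ^+ 2 * (4 * i ^+ 2 - 5 / 2 * i ^+ 4) <= D ^+ 2 * (4 * i' ^+ 2 - i' * i ^+ 3 / 2).
  by rewrite ler_wpM2l ?sqr_ge0//; lra.
have : 0 < D ^+ 2 * i ^+ 4 by rewrite mulr_gt0 ?exprn_gt0.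
lra.
Qed.

(** * Follow the regularized leader *)

Lemma sum_inv_fourth_root {R : realFieldType} (w : nat -> R) (m : nat) :
  (forall t, 0 <= w t) -> (forall t, w t ^+ 4 = t%:R) ->
  \sum_(1 <= t < m.+1) (w t)^-1 <= 4 / 3 * w m ^+ 3.
Proof.
move=> w0 w4; elim: m => [|m IHm]; first by rewrite big_nil mulr_ge0 ?exprn_ge0.
rewrite big_nat_recr//=; apply: le_trans (lerD IHm (lexx _)) _.
have wm4 : w m.+1 ^+ 4 = w m ^+ 4 + 1 by rewrite !w4 -natr1.
have wm0 : 0 < w m.+1.
  rewrite lt_neqAle w0 andbT eq_sym; apply/eqP => wm.
  by move: (w4 m.+1); rewrite wm expr0n => /esym/eqP; rewrite pnatr_eq0.
rewrite -lerBrDl -mulrBr -[leLHS]div1r ler_pdivrMr//.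
move: (w m.+1) (w m) (w0 m) wm0 wm4 => a b b0 a0 ab.
(* With [a^4 - b^4 = 1], the goal amounts to [a^4 - 4 a b^3 + 3 b^4 >= 0], which factors in this
   way. *)
have : 0 <= (a - b) ^+ 2 * (a ^+ 2 + 2 * (a * b) + 3 * b ^+ 2).
  by rewrite mulr_ge0 ?sqr_ge0// !addr_ge0 ?mulr_ge0 ?exprn_ge0 ?(ltW a0).
lra.
Qed.

Section FollowTheLeader.
Context {R : realType} {n : nat}.
Implicit Types (S B g : 'M[R]_n).

Lemma quad_objD eta C1 S g B :
  quad_obj eta C1 (S + g) B = quad_obj eta C1 S B + eta * mxdot g B.
Proof. by rewrite /quad_obj mxdotDl; ring. Qed.

(** Induction on the rounds: the old leader does at least as well on the old objective as the new
    one, and both sides then gain the same term for the new round. *)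
Lemma be_the_leader (K : set 'M[R]_n) eta (C1 : 'M[R]_n) (g M : nat -> 'M[R]_n) m :
  (forall t, is_argmin K (quad_obj eta C1 (\sum_(1 <= s < t) g s)) (M t)) ->
  \sum_(1 <= t < m.+1) eta * mxdot (g t) (M t.+1)
  <= quad_obj eta C1 (\sum_(1 <= s < m.+1) g s) (M m.+1).
Proof.
move=> minM; elim: m => [|m IHm].
  rewrite !big_nil /quad_obj mxdot0l mulr0 add0r.
  exact: mxdot_ge0.
rewrite big_nat_recr//= [in leRHS]big_nat_recr//= quad_objD lerD2r (le_trans IHm)//.
exact: (minM m.+1).2 (minM m.+2).1.
Qed.

(** Adding the quadratic growth at both minimizers gives [2 |M - M'|^2 <= eta <g, M - M'>];
    Cauchy-Schwarz bounds the right side by [eta G |M - M'|]. *)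
Lemma leader_stability (K : set 'M[R]_n) eta C1 S g M M' G :
  0 < eta -> mx_convex K -> fnorm g <= G ->
  is_argmin K (quad_obj eta C1 S) M -> is_argmin K (quad_obj eta C1 (S + g)) M' ->
  mxdot g (M - M') <= eta * G ^+ 2 / 2.
Proof.
move=> eta0 cK gG minM minM'.
have := argmin_quad_growth _ _ _ _ _ _ cK minM minM'.1.
have := argmin_quad_growth _ _ _ _ _ _ cK minM' minM.1.
rewrite !quad_objD.
have -> : fnorm (M' - M) = fnorm (M - M').
  by rewrite /fnorm -opprB mxdotNl mxdotNr opprK.
have := mxdot_le_fnorm g (M - M'); have := fnorm_ge0 (M - M').
have := ler_wpM2r (fnorm_ge0 (M - M')) gG.
rewrite !(mxdotDr g) mxdotNr.
move: (fnorm (M - M')) (mxdot g M) (mxdot g M') => y a b.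
move: (quad_obj _ _ _ M) (quad_obj _ _ _ M') => p q.
move=> yG y0 ab h1 h2.
have h : 2 * y ^+ 2 <= eta * (a - b) by lra.
have h' : eta * (a - b) <= eta * (G * y) by rewrite ler_pM2l//; lra.
rewrite -(ler_pM2l eta0).
(* The square gives [eta G y <= y^2 + (eta G)^2 / 4], and [h] absorbs [y^2], which avoids dividing
   by [y]. *)
have := sqr_ge0 (y - eta * G / 2); lra.
Qed.

(** Each term splits at [M t.+1]: stability bounds the first part, and be-the-leader bounds the
    second by the regularizer at [u] over [eta]. *)
Lemma ftrl_regret (K : set 'M[R]_n) eta C1 (g M : nat -> 'M[R]_n) D G m u :
  0 < eta -> mx_convex K -> (forall t, (1 <= t <= m)%N -> fnorm (g t) <= G) ->
  (forall t, is_argmin K (quad_obj eta C1 (\sum_(1 <= s < t) g s)) (M t)) ->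
  K u -> fnorm (u - C1) <= D ->
  \sum_(1 <= t < m.+1) mxdot (g t) (M t - u)
  <= D ^+ 2 / eta + m%:R * (eta * G ^+ 2 / 2).
Proof.
move=> eta0 cK gG minM Ku uD.
have stab : \sum_(1 <= t < m.+1) mxdot (g t) (M t - M t.+1)
    <= m%:R * (eta * G ^+ 2 / 2).
  rewrite [leRHS](_ : _ = \sum_(1 <= t < m.+1) (eta * G ^+ 2 / 2)); last first.
    by rewrite sumr_const_nat subn1 mulr_natl.
  rewrite !big_nat ler_sum// => t t1m.
  apply: (leader_stability _ _ _ _ _ _ _ _ eta0 cK (gG t t1m) (minM t)).
  by have := minM t.+1; rewrite big_nat_recr//; case/andP: t1m.
have btl := le_trans (be_the_leader K eta C1 g M m minM) ((minM m.+1).2 u Ku).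
rewrite (eq_bigr (fun t => mxdot (g t) (M t - M t.+1) + mxdot (g t) (M t.+1 - u))); last first.
  by move=> t _; rewrite -mxdotDr addrA subrK.
rewrite big_split/= addrC lerD//.
rewrite ler_pdivlMr// mulrC mulr_sumr.
rewrite (eq_bigr (fun t => eta * mxdot (g t) (M t.+1) - eta * mxdot (g t) u)); last first.
  by move=> t _; rewrite mxdotDr mxdotNr mulrBr.
rewrite sumrB lerBlDr (le_trans btl)// /quad_obj mxdot_suml mulr_sumr addrC lerD2r.
by rewrite -fnorm_sqr ler_pXn2r ?nnegrE ?fnorm_ge0// (le_trans _ uD)// fnorm_ge0.
Qed.

End FollowTheLeader.

(** * Regret of the online conditional gradient method *)

Lemma iterate_gap_le {R : realType} {n} (K : set 'M[R]_n) (w : nat -> R) (D G eta : R)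
    (T : nat) (g C V M : nat -> 'M[R]_n) :
  (forall t, 0 <= w t) -> (forall t, w t ^+ 4 = t%:R) ->
  0 < D -> 0 < G -> eta = D / (4 * G * w T ^+ 3) -> mx_convex K ->
  (forall A B, K A -> K B -> fnorm (A - B) <= D) ->
  (forall t, (1 <= t <= T)%N -> fnorm (g t) <= G) ->
  (forall t, (1 <= t <= T)%N -> K (C t)) ->
  (forall t, (1 <= t <= T)%N ->
    is_argmin K (fun B => mxdot B (eta *: \sum_(1 <= s < t) g s + 2 *: (C t - C 1%N))) (V t)) ->
  (forall t, (1 <= t <= T)%N ->
    C t.+1 = (1 - 1 / w t ^+ 2) *: C t + (1 / w t ^+ 2) *: V t) ->
  (forall t, is_argmin K (quad_obj eta (C 1%N) (\sum_(1 <= s < t) g s)) (M t)) ->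
  forall t, (1 <= t <= T)%N -> fnorm (C t - M t) <= 2 * D / w t.
Proof.
move=> w0 w4 D0 G0 etaE cK KD gG KC minV CS minM.
pose F t := quad_obj eta (C 1%N) (\sum_(1 <= s < t) g s).
pose h t := F t (C t) - F t (M t).
have growth t : (1 <= t <= T)%N -> fnorm (C t - M t) ^+ 2 <= h t.
  by move=> tT; apply: argmin_quad_growth (minM t) (KC t tT).
have h0 t : (1 <= t <= T)%N -> 0 <= h t.
  by move=> /growth; apply: le_trans; exact: sqr_ge0.
have distle t : (1 <= t <= T)%N -> fnorm (C t - M t) <= Num.sqrt (h t).
  move=> tT; rewrite -(@ler_pXn2r _ 2) ?nnegrE ?fnorm_ge0 ?sqrtr_ge0//.
  by rewrite [leRHS]sqr_sqrtr ?h0 ?growth.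
have wmono s t : (s <= t)%N -> w s <= w t.
  by move=> st; rewrite -(@ler_pXn2r _ 4) ?nnegrE// !w4 ler_nat.
have w_ge1 t : (1 <= t)%N -> 1 <= w t.
  by move=> t1; rewrite -(@ler_pXn2r _ 4) ?nnegrE// w4 expr1n ler1n.
have eta0 t : (1 <= t <= T)%N -> 0 < eta /\ eta * G <= D / (4 * w t ^+ 3).
  case/andP=> t1 tT; have wt := w_ge1 _ t1; have wT := w_ge1 _ (leq_trans t1 tT).
  have wt0 : 0 < w t by lra.
  have wT0 : 0 < w T by lra.
  rewrite etaE; split; first by rewrite divr_gt0 ?mulr_gt0 ?exprn_gt0.
  rewrite (_ : _ * G = D / (4 * w T ^+ 3)).
    rewrite ler_pM2l// lef_pV2 ?posrE ?mulr_gt0 ?exprn_gt0// ler_pM2l//.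
    by rewrite ler_pXn2r ?nnegrE ?w0// wmono.
  by field; rewrite !gt_eqF.
suff gap t : (1 <= t <= T)%N -> Num.sqrt (h t) <= 2 * D / w t.
  by move=> t tT; exact: le_trans (distle _ tT) (gap _ tT).
elim: t => // -[_ T1|t IHt tT].
  (* In round 1 the gradient sum is empty and [C 1] minimizes the regularizer. *)
  have h1 : h 1%N <= 0.
    rewrite /h /F big_geq// /quad_obj subrr !mxdot0l mulr0 !add0r.
    by rewrite oppr_le0 mxdot_ge0.
  by rewrite ler0_sqrtr// divr_ge0 ?mulr_ge0 ?(ltW D0).
have tT' : (1 <= t.+1 <= T)%N by case/andP: tT => _ /ltnW ->.
have [e0 eG] := eta0 _ tT'.
have wt := w_ge1 t.+1 isT; have wt' := w_ge1 t.+2 isT.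
apply: (@gap_recursion _ D (eta * G) (w t.+1) (w t.+2) (Num.sqrt (h t.+1))) => //.
- lra.
- by rewrite !w4 natr1.
- by rewrite sqrtr_ge0 IHt.
rewrite !sqr_sqrtr ?h0//.
(* The new round adds [eta <g, C - M>] at index [t.+2] to the gap. Bounding it by the root of the
   new gap puts that gap on both sides, the shape that [gap_recursion] resolves. *)
have FS B : F t.+2 B = F t.+1 B + eta * mxdot (g t.+1) B.
  by rewrite /F big_nat_recr//= quad_objD.
have step0 : 0 <= 1 / w t.+1 ^+ 2 by rewrite divr_ge0 ?exprn_ge0.
have := conditional_gradient_step _ _ _ _ _ _ _ _ step0 (minM t.+1).1 (minV _ tT').
rewrite -CS// -/(F t.+1) -/(h t.+1) => step.
have dV : fnorm (V t.+1 - C t.+1) ^+ 2 <= D ^+ 2.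
  rewrite ler_pXn2r ?nnegrE ?fnorm_ge0 ?(ltW D0)//.
  by apply: KD; [exact: (minV _ tT').1|exact: KC].
have lead := (minM t.+1).2 _ (minM t.+2).1; rewrite -/(F t.+1) in lead.
have dg : mxdot (g t.+1) (C t.+2 - M t.+2) <= G * Num.sqrt (h t.+2).
  apply: le_trans (mxdot_le_fnorm _ _) _.
  by rewrite ler_pM ?fnorm_ge0 ?gG ?distle.
move: (Num.sqrt (h t.+2)) dg => y dg.
have := ler_wpM2l (ltW e0) dg; have := ler_wpM2l (sqr_ge0 (1 / w t.+1 ^+ 2)) dV.
have -> : h t.+2 = F t.+2 (C t.+2) - F t.+2 (M t.+2) by [].
rewrite !FS mxdotDr mxdotNr; lra.
Qed.

Lemma online_conditional_gradient_regret {R : realType} {n} (K : set 'M[R]_n)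
    (w : nat -> R) (D G eta : R) (T : nat) (g C V : nat -> 'M[R]_n) u :
  (forall t, 0 <= w t) -> (forall t, w t ^+ 4 = t%:R) -> (1 <= T)%N ->
  0 < D -> 0 < G -> eta = D / (4 * G * w T ^+ 3) -> mx_convex K ->
  (forall S, exists M, is_argmin K (quad_obj eta (C 1%N) S) M) ->
  (forall A B, K A -> K B -> fnorm (A - B) <= D) ->
  (forall t, (1 <= t <= T)%N -> fnorm (g t) <= G) ->
  (forall t, (1 <= t <= T)%N -> K (C t)) ->
  (forall t, (1 <= t <= T)%N ->
    is_argmin K (fun B => mxdot B (eta *: \sum_(1 <= s < t) g s + 2 *: (C t - C 1%N))) (V t)) ->
  (forall t, (1 <= t <= T)%N ->
    C t.+1 = (1 - 1 / w t ^+ 2) *: C t + (1 / w t ^+ 2) *: V t) ->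
  K u ->
  \sum_(1 <= t < T.+1) mxdot (g t) (C t - u) <= 12 * D * G * w T ^+ 3 + D * G * w T.
Proof.
move=> w0 w4 T1 D0 G0 etaE cK minE KD gG KC minV CS Ku.
have [M minM] := choice (fun t => minE (\sum_(1 <= s < t) g s)).
have gap := @iterate_gap_le _ _ _ _ _ _ _ _ _ _ _ _ w0 w4 D0 G0 etaE cK KD gG KC minV CS minM.
have wT : 0 < w T.
  rewrite lt_neqAle w0 andbT eq_sym; apply/eqP => wT0; move: (w4 T).
  by rewrite wT0 expr0n => /esym/eqP; rewrite pnatr_eq0 -leqn0 leqNgt T1.
have eta0 : 0 < eta by rewrite etaE divr_gt0 ?mulr_gt0 ?exprn_gt0.
have K1 : K (C 1%N) by apply: KC; rewrite T1.
have ftrl := ftrl_regret _ _ _ _ _ _ _ _ _ eta0 cK gG minM Ku (KD _ _ Ku K1).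
rewrite (eq_bigr (fun t => mxdot (g t) (C t - M t) + mxdot (g t) (M t - u))); last first.
  by move=> t _; rewrite -mxdotDr addrA subrK.
rewrite big_split/=.
have : \sum_(1 <= t < T.+1) mxdot (g t) (C t - M t) <= G * (2 * D * (4 / 3 * w T ^+ 3)).
  apply: le_trans (_ : _ <= G * (2 * D * \sum_(1 <= t < T.+1) (w t)^-1)) _; last first.
    by rewrite !ler_pM2l ?mulr_gt0// sum_inv_fourth_root.
  rewrite !mulr_sumr !big_nat ler_sum// => t tT.
  by apply: le_trans (mxdot_le_fnorm _ _) _; rewrite ler_pM ?fnorm_ge0 ?gG ?gap.
have E1 : D ^+ 2 / eta = 4 * D * G * w T ^+ 3.
  by rewrite etaE; field; rewrite !gt_eqF ?exprn_gt0.
have E2 : T%:R * (eta * G ^+ 2 / 2) = D * G * w T / 8.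
  by rewrite etaE -w4; field; rewrite !gt_eqF ?exprn_gt0.
rewrite E1 E2 in ftrl.
(* The coefficients add up to [8/3 + 4 = 20/3] for the cube and [1/8] for [w T]; nonnegativity
   relaxes them to 12 and 1. *)
have : 0 <= D * G * w T ^+ 3 by rewrite !mulr_ge0 ?exprn_ge0 ?ltW.
have : 0 <= D * G * w T by rewrite !mulr_ge0 ?ltW.
lra.
Qed.

(** * Existence of minimizers and application to the OCCFM run *)

Lemma compact_is_argmin {R : realType} {n} (K : set 'M[R]_n) (f : 'M[R]_n -> R) :
  compact K -> K !=set0 -> continuous f -> exists M, is_argmin K f M.
Proof.
move=> cK K0 cf; have [M /set_mem KM minM] := compact_EVT_min K0 cK (continuous_subspaceT cf).
by exists M; split=> // B KB; apply: minM; rewrite inE.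
Qed.

Lemma quad_obj_continuous {R : realType} {n} eta (C1 S : 'M[R]_n) :
  continuous (quad_obj eta C1 S).
Proof.
rewrite (_ : quad_obj eta C1 S = fun B => eta * mxdot S B +
    \sum_i \sum_j (B i j - C1 i j) * (B i j - C1 i j)); last first.
  apply/funext => B; rewrite /quad_obj [mxdot (B - _) _]mxdotE.
  by congr (_ + _); apply: eq_bigr => i _; apply: eq_bigr => j _; rewrite !mxE.
have centry i j : continuous (fun B : 'M[R]_n => B i j - C1 i j).
  by move=> B; apply: continuousB; [exact: coord_continuous|exact: cst_continuous].
have csq : continuous (fun B : 'M[R]_n =>
    \sum_i \sum_j (B i j - C1 i j) * (B i j - C1 i j)).
  apply: continuous_sumr => i _; apply: continuous_sumr => j _ B.
  exact: (continuousM (centry i j B) (centry i j B)).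
have clin : continuous (fun B => eta * mxdot S B).
  have ceta : continuous (fun _ : 'M[R]_n => eta) by exact: cst_continuous.
  move=> B; exact: (continuousM (ceta B) (mxdot_continuous S B)).
by move=> B; exact: (continuousD (clin B) (csq B)).
Qed.

Lemma powR_divn {R : realType} (a : R) (k m : nat) : 0 <= a ->
  a `^ (k%:R / m%:R) = (a `^ (1 / m%:R)) ^+ k.
Proof.
by move=> a0; rewrite -powR_mulrn ?powR_ge0// -powRrM mulrC div1r.
Qed.

Lemma occfm_run_mem {R : realType} {d : nat} (delta eta : R) gamma (T : nat)
    (f : nat -> 'M[R]_(d + 1) -> R) C Chat :
  occfm_run delta eta gamma T f C Chat ->
  (forall t, (1 <= t <= T)%N -> 0 <= gamma t <= 1) ->
  forall t, (1 <= t <= T.+1)%N -> nuclear_ball delta (C t).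
Proof.
move=> run g01; elim=> // -[_ _|t IHt /= tT]; first exact: occfm_init run.
have {}tT : (1 <= t.+1 <= T)%N by [].
rewrite (occfm_update run)//; apply: nuclear_ball_convex.
- exact: g01.
- by apply: IHt; rewrite /= ltnS ltnW.
- by have [[]] := occfm_linear run tT.
Qed.

Theorem theorem3 (R : realType) (d T : nat) (hT : (1 <= T)%N)
  (delta D G : R) (hdelta : 0 < delta)
  (x : nat -> 'cV[R]_d) (ell : nat -> R -> R)
  (hconvex : forall t, (1 <= t <= T)%N -> convex_function setT (ell t))
  (hdiff : forall t, (1 <= t <= T)%N -> forall r : R, derivable (ell t) r 1)
  (hD : forall A B : 'M[R]_(d + 1),
    nuclear_ball delta A -> nuclear_ball delta B -> fnorm (A - B) <= D)
  (hG : forall t, (1 <= t <= T)%N -> forall A : 'M[R]_(d + 1),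
    nuclear_ball delta A -> fnorm (grad (loss (x t) (ell t)) A) <= G)
  (C Chat : nat -> 'M[R]_(d + 1))
  (hrun : occfm_run delta (D / (4 * G * T%:R `^ (3 / 4)))
    (fun t => 1 / t%:R `^ (1 / 2)) T (fun t => loss (x t) (ell t)) C Chat) :
  exists2 Cstar : 'M[R]_(d + 1),
    is_argmin (nuclear_ball delta)
      (fun B => \sum_(1 <= t < T.+1) loss (x t) (ell t) B) Cstar &
    \sum_(1 <= t < T.+1) loss (x t) (ell t) (C t)
    - \sum_(1 <= t < T.+1) loss (x t) (ell t) Cstar
    <= 12 * D * G * T%:R `^ (3 / 4) + D * G * T%:R `^ (1 / 4).
Proof.
have K0 : nuclear_ball delta (0 : 'M[R]_(d + 1)) by apply: nuclear_ball0; exact: ltW.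
have cK := @nuclear_ball_compact R (d + 1) delta.
have [Cstar minCstar] : exists M, is_argmin (nuclear_ball delta)
    (fun B => \sum_(1 <= t < T.+1) loss (x t) (ell t) B) M.
  apply: compact_is_argmin => //; first by exists 0.
  (* Puts the index range into the summation predicate, as [hdiff] holds only on that range. *)
  under eq_fun do rewrite big_nat.
  by apply: continuous_sumr => t tT; apply: loss_continuous; exact: hdiff.
exists Cstar => //.
(* All real powers in the statement become integer powers of this fourth root. *)
pose w t : R := t%:R `^ (1 / 4).
have w0 t : 0 <= w t by exact: powR_ge0.
have w4 t : w t ^+ 4 = t%:R by rewrite -powR_divn// divff// powRr1.
have w2 t : t%:R `^ (1 / 2) = w t ^+ 2.
  by rewrite -powR_divn//; congr (_ `^ _); field.
have w3 : T%:R `^ (3 / 4) = w T ^+ 3 by rewrite powR_divn.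
have hrun' := hrun; rewrite w3 in hrun'.
have w_ge1 t : (1 <= t)%N -> 1 <= w t.
  by move=> t1; rewrite -(@ler_pXn2r _ 4) ?nnegrE// w4 expr1n ler1n.
(* Positivity of [eta] forces [D] and [G] to be positive, since division by zero yields 0. *)
have eta0 := occfm_eta_gt0 hrun'.
have D0 : 0 < D.
  have : 0 <= D by apply: le_trans (hD 0 0 K0 K0); exact: fnorm_ge0.
  rewrite le_eqVlt => /predU1P[D0|//].
  by move: eta0; rewrite -D0 mul0r ltxx.
have wT0 : 0 < w T ^+ 3 by rewrite exprn_gt0// (lt_le_trans _ (w_ge1 _ hT)).
have G0 : 0 < G.
  by move: eta0; rewrite pmulr_rgt0// invr_gt0 (pmulr_lgt0 _ wT0) pmulr_rgt0.
have KC t : (1 <= t <= T.+1)%N -> nuclear_ball delta (C t).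
  apply: (occfm_run_mem _ _ _ _ _ _ _ hrun) => s /andP[s1 _].
  rewrite w2 divr_ge0 ?exprn_ge0//= ler_pdivrMr.
    by rewrite mul1r exprn_ege1// w_ge1.
  by rewrite exprn_gt0// (lt_le_trans _ (w_ge1 _ s1)).
have KC' t : (1 <= t <= T)%N -> nuclear_ball delta (C t).
  by case/andP=> t1 tT; apply: KC; rewrite t1 ltnW.
pose g t := grad (loss (x t) (ell t)) (C t).
apply: (@le_trans _ _ (\sum_(1 <= t < T.+1) mxdot (g t) (C t - Cstar))).
  rewrite -sumrB !big_nat ler_sum// => t tT; apply: loss_tangent_le.
    exact: hconvex.
  exact: hdiff.
rewrite w3.
apply: (@online_conditional_gradient_regret _ _ (nuclear_ball delta) w D G
    (D / (4 * G * w T ^+ 3)) T g C Chat) => //.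
- by move=> t A B; exact: nuclear_ball_convex.
- move=> S; apply: compact_is_argmin => //; first by exists 0.
  exact: quad_obj_continuous.
- by move=> t tT; apply: hG => //; exact: KC'.
- by move=> t tT; have [] := occfm_linear hrun' tT; rewrite grad_surrogate.
- by move=> t tT; rewrite (occfm_update hrun' tT) w2.
- exact: minCstar.1.
Qed.
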